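(* Let $n \geq 1$, let $g:[0,\infty)\to\mathbb{R}$ be continuous with $g(0)=0$, and let $\mu$ be a Borel measure on $\mathbb{R}^n$ with $0<\mu(\mathbb{R}^n)<\infty$. Assume $\mu$ has compact support. Let $V=V_\mu:\mathbb{R}^n\to\mathbb{R}^n$ be the vector field $V(x)=\int_{\mathbb{R}^n} v(x+y)\,d\mu(y)$, where $v(y)=g(|y|)\,y/|y|$ for $y\neq 0$ and $v(0)=0$. (a) [Existence] If $\int_0^\infty g(r)\,dr=\infty$ then $V(x_c)=0$ for some $x_c\in\mathbb{R}^n$. (b) [Uniqueness] If either (i) $g$ is strictly increasing, or (ii) $g$ is increasing, $g(r)>0$ for all $r>0$, and $\mu$ is not supported in a line, then the point $x_c$ with $V(x_c)=0$ is unique. (c) [Continuous dependence] Suppose $\mu_k\to\mu$ weakly as $k \to \infty$, where the $\mu_k$ ($k=1,2,3,\dots$) are Borel measures all supported in a fixed compact set in $\mathbb{R}^n$ and satisfying $0<\mu_k(\mathbb{R}^n)<\infty$. If either (i) holds, or else (ii) holds for $\mu$ and also for each $\mu_k$ (in place of $\mu$), then $x_c(\mu_k)\to x_c(\mu)$ as $k\to\infty$, where $x_c(\nu)$ denotes the unique zero of $V_\nu(x)=\int_{\mathbb{R}^n} v(x+y)\,d\nu(y)$.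
   Context: ''Increasing'' means non-strictly increasing (nondecreasing). The condition $\int_0^\infty g(r)\,dr=\infty$ is understood as an improper integral: $\int_0^\rho g(r)\,dr\to\infty$ as $\rho\to\infty$. ''$\mu$ is not supported in a line'' means $\mu(\mathbb{R}^n\setminus L)>0$ for every (affine) line $L$ in $\mathbb{R}^n$. Weak convergence $\mu_k\to\mu$ means $\int_{\mathbb{R}^n}\psi\,d\mu_k\to\int_{\mathbb{R}^n}\psi\,d\mu$ for every bounded continuous function $\psi$ on $\mathbb{R}^n$. *)

(* Defs.v *)
From HB Require Import structures.
From mathcomp Require Import all_boot all_order all_algebra.
From mathcomp Require Import all_classical all_reals all_analysis.
Import Order.TTheory GRing.Theory Num.Theory.
Import numFieldNormedType.Exports.
Set Implicit Arguments.
Unset Strict Implicit.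
Unset Printing Implicit Defensive.
Local Open Scope classical_set_scope.
Local Open Scope ring_scope.

(* R^n is 'rV[R]_n. Its library norm is the sup norm, which induces the usual
   topology; the Euclidean length is [enorm] below. *)

(* R^n with its Borel sigma-algebra. *)
Definition borelRn (R : realType) (n : nat) :=
  g_sigma_algebraType (@open 'rV[R]_n).

Section Defs.
Context {R : realType} {n : nat}.
Implicit Types (g : R -> R) (mu : {measure set (borelRn R n) -> \bar R}).

Definition enorm (y : 'rV[R]_n) : R := Num.sqrt (\sum_(i < n) y ord0 i ^+ 2).

(* A function on [0, +oo[ is represented by g : R -> R, of which only the
   values on [0, +oo[ are ever used, here and below. *)
Definition radial g (y : 'rV[R]_n) : 'rV[R]_n :=
  if y == 0 then 0 else g (enorm y) *: ((enorm y)^-1 *: y).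

(* The vector-valued integral is taken componentwise. *)
Definition vfield g mu (x : 'rV[R]_n) : 'rV[R]_n :=
  \row_(i < n) \int[mu]_(y in setT) (radial g (x + y) ord0 i).

Definition improper_integral_infty g : Prop :=
  (\int[lebesgue_measure]_(r in `[0, rho]) g r) @[rho --> +oo] --> +oo.

Definition strictly_increasing g : Prop :=
  {in `[0, +oo[ &, {homo g : r s / r < s}}.

Definition increasing g : Prop :=
  {in `[0, +oo[ &, {homo g : r s / r <= s}}.

Definition finite_nonzero mu : Prop := (0 < mu setT /\ mu setT < +oo)%E.

Definition msupport mu : set 'rV[R]_n :=
  [set x | forall U : set 'rV[R]_n, open U -> U x -> (0 < mu U)%E].

Definition compactly_supported mu : Prop := compact (msupport mu).

Definition supported_in mu (A : set 'rV[R]_n) : Prop := mu (~` A) = 0%E.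

Definition affine_line (a b : 'rV[R]_n) : set 'rV[R]_n :=
  [set a + t *: b | t in [set: R]].

(* For n = 1 the only affine line is R^1 itself, so this fails for every mu. *)
Definition not_supported_in_line mu : Prop :=
  forall a b : 'rV[R]_n, b != 0 -> (0 < mu (~` affine_line a b))%E.

Definition uniq_cond_ii g mu : Prop :=
  [/\ increasing g, forall r : R, 0 < r -> 0 < g r & not_supported_in_line mu].

Definition weak_cvg (mu_ : nat -> {measure set (borelRn R n) -> \bar R}) mu :
    Prop :=
  forall psi : 'rV[R]_n -> R, continuous psi -> bounded_fun psi ->
    (\int[mu_ k]_(y in setT) psi y) @[k --> \oo] --> \int[mu]_(y in setT) psi y.

(* The zero of the field when it exists and is unique; [get] returns an
   arbitrary value if there is no zero. *)
Definition zero_point g mu : 'rV[R]_n := get [set x | vfield g mu x = 0].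

End Defs.

(* Main.v *)
(* V is the gradient of E(x) = \int G(|x + y|) dmu(y), where G is a primitive
   of g. If G tends to +oo then E has a global minimum, which is a zero of V.
   If g is increasing then v is monotone: with a = |p| and b = |q|,
     <v p - v q, p - q> = (g a - g b) (a - b)
                          + (g a / a + g b / b) (a b - <p, q>),
   a sum of two nonnegative terms; under (i), or under (ii) after integration,
   V is strictly monotone, so its zero is unique. For continuous dependence,
   strict monotonicity of V_mu bounds <V_mu x, x - x_c> from below on a small
   sphere around x_c, weak convergence transfers this to V_(mu_k), and the
   monotonicity of V_(mu_k) forces its zero to be inside the sphere. *)
Require Import Defs.
From HB Require Import structures.
From mathcomp Require Import all_boot all_order all_algebra.
From mathcomp Require Import all_classical all_reals all_analysis.
From mathcomp Require Import measurable_realfun ring lra.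
Import Order.TTheory GRing.Theory Num.Theory.
Import numFieldNormedType.Exports.
Local Open Scope classical_set_scope.
Local Open Scope ring_scope.

Set Implicit Arguments.
Unset Strict Implicit.
Unset Printing Implicit Defensive.

(** * Euclidean inner product, norm and balls on row vectors *)

Section Euclid.
Context {R : realType} {n : nat}.
Implicit Types (x y z u : 'rV[R]_n) (a b c r t : R).

Definition dot x y : R := \sum_(i < n) x ord0 i * y ord0 i.

Lemma dotC x y : dot x y = dot y x.
Proof. by apply: eq_bigr => i _; rewrite mulrC. Qed.

Lemma dotDl x y z : dot (x + y) z = dot x z + dot y z.
Proof. by rewrite /dot -big_split; apply: eq_bigr => i _; rewrite mxE mulrDl. Qed.

Lemma dotZl a x z : dot (a *: x) z = a * dot x z.
Proof. by rewrite /dot mulr_sumr; apply: eq_bigr => i _; rewrite mxE mulrA. Qed.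

Lemma dotNl x z : dot (- x) z = - dot x z.
Proof. by rewrite -scaleN1r dotZl mulN1r. Qed.

Lemma dotBl x y z : dot (x - y) z = dot x z - dot y z.
Proof. by rewrite dotDl dotNl. Qed.

Lemma dotDr x y z : dot z (x + y) = dot z x + dot z y.
Proof. by rewrite dotC dotDl !(dotC z). Qed.

Lemma dotZr a x z : dot z (a *: x) = a * dot z x.
Proof. by rewrite dotC dotZl (dotC z). Qed.

Lemma dotNr x z : dot z (- x) = - dot z x.
Proof. by rewrite dotC dotNl (dotC z). Qed.

Lemma dotBr x y z : dot z (x - y) = dot z x - dot z y.
Proof. by rewrite dotDr dotNr. Qed.

Lemma dot0l x : dot 0 x = 0.
Proof. by rewrite -(scale0r 0) dotZl mul0r. Qed.

Lemma enorm_ge0 x : 0 <= enorm x.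
Proof. exact: sqrtr_ge0. Qed.

Lemma sqr_enorm x : enorm x ^+ 2 = dot x x.
Proof.
rewrite sqr_sqrtr; last by apply: sumr_ge0 => i _; exact: sqr_ge0.
by apply: eq_bigr => i _; rewrite expr2.
Qed.

Lemma ler_coord_enorm x i : `|x ord0 i| <= enorm x.
Proof.
rewrite -(ler_pXn2r (n := 2)) ?nnegrE ?enorm_ge0// sqr_enorm real_normK ?num_real//.
rewrite /dot (bigD1 i)//= expr2 lerDl sumr_ge0// => j _.
by rewrite -expr2 sqr_ge0.
Qed.

Lemma enorm_eq0 x : (enorm x == 0) = (x == 0).
Proof.
apply/eqP/eqP => [x0|->].
  apply/rowP => i; rewrite mxE; apply/eqP.
  by rewrite -normr_le0 -x0 ler_coord_enorm.
by apply/eqP; rewrite -sqrf_eq0 sqr_enorm dot0l.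
Qed.

Lemma enorm0 : enorm (0 : 'rV[R]_n) = 0.
Proof. by apply/eqP; rewrite enorm_eq0. Qed.

Lemma enorm_gt0 x : (0 < enorm x) = (x != 0).
Proof. by rewrite lt0r enorm_ge0 andbT enorm_eq0. Qed.

Lemma enormZ a x : enorm (a *: x) = `|a| * enorm x.
Proof.
apply/eqP; rewrite -(eqrXn2 (n := 2)) ?mulr_ge0 ?enorm_ge0//.
by rewrite exprMn !sqr_enorm dotZl dotZr real_normK ?num_real// expr2 mulrA.
Qed.

Lemma enormN x : enorm (- x) = enorm x.
Proof. by rewrite -scaleN1r enormZ normrN1 mul1r. Qed.

(** With a = |x|, b = |y| and p = <x, y>, the square |b x - a y|^2 equals 2 a b (a b - p); the
    positive factor a b cancels. *)
Lemma dot_le_enorm x y : dot x y <= enorm x * enorm y.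
Proof.
have [->|x0] := eqVneq x 0; first by rewrite dot0l enorm0 mul0r.
have [->|y0] := eqVneq y 0; first by rewrite dotC dot0l enorm0 mulr0.
have ab : 0 < enorm x * enorm y by rewrite mulr_gt0// enorm_gt0.
have : 0 <= enorm (enorm y *: x - enorm x *: y) ^+ 2 by exact: sqr_ge0.
rewrite sqr_enorm !(dotBl, dotBr, dotZl, dotZr) -!sqr_enorm (dotC y x).
set a := enorm x in ab *; set b := enorm y in ab *; set p := dot x y => h.
have : 0 <= (a * b) * (a * b - p) by nra.
by rewrite pmulr_rge0// subr_ge0.
Qed.

Lemma normr_dot_le x y : `|dot x y| <= enorm x * enorm y.
Proof.
rewrite ler_norml dot_le_enorm andbT lerNl -dotNl (le_trans (dot_le_enorm _ _))//.
by rewrite enormN.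
Qed.

Lemma ler_enormD x y : enorm (x + y) <= enorm x + enorm y.
Proof.
rewrite -(ler_pXn2r (n := 2)) ?nnegrE ?addr_ge0 ?enorm_ge0//.
have := dot_le_enorm x y.
rewrite sqr_enorm !(dotDl, dotDr) -!sqr_enorm (dotC y x); nra.
Qed.

Lemma ler_dist_enorm x y : `|enorm x - enorm y| <= enorm (x - y).
Proof.
have h u v : enorm u - enorm v <= enorm (u - v :> 'rV_n).
  by rewrite lerBlDr (le_trans _ (ler_enormD _ _))// subrK.
by rewrite ler_norml h andbT lerNl opprB -[leRHS]enormN opprB h.
Qed.

(** Limits and boundedness refer to the sup norm; this bound transfers Euclidean estimates to
    them. *)
Lemma normr_le_enorm x : `|x| <= enorm x.
Proof.
rewrite [leLHS]/Num.Def.normr/= mx_normrE; apply: bigmax_le => [|[i j] _ /=].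
  exact: enorm_ge0.
by rewrite (ord1 i) ler_coord_enorm.
Qed.

Lemma continuous_coord_comp (T : topologicalType) (f : T -> 'rV[R]_n) i :
  continuous f -> continuous (fun p => f p ord0 i).
Proof.
by move=> cf p; exact: (continuous_comp (cf p) (@coord_continuous R 1 n ord0 i _)).
Qed.

Lemma dot_continuous (T : topologicalType) (f h : T -> 'rV[R]_n) :
  continuous f -> continuous h -> continuous (fun p => dot (f p) (h p)).
Proof.
move=> cf ch p; apply: (@cvg_big _ _ +%R) => [|i _]; first exact: add_continuous.
by apply: cvgM; [exact: continuous_coord_comp|exact: continuous_coord_comp].
Qed.

Lemma enorm_continuous : continuous (@enorm R n).
Proof.
move=> x; rewrite (_ : @enorm R n = Num.sqrt \o (fun x => dot x x)).
  apply: continuous_comp; last exact: sqrt_continuous.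
  have ci : continuous (@id 'rV[R]_n) by move=> ?; exact: cvg_id.
  exact: dot_continuous.
by apply/funext => y /=; congr Num.sqrt; apply: eq_bigr => i _; rewrite expr2.
Qed.

Lemma subr_continuous x : continuous (fun y : 'rV[R]_n => y - x).
Proof.
by move=> y; apply: (@continuousB _ _ _ id (cst x)) => //; exact: cst_continuous.
Qed.

Lemma enorm_subr_continuous x : continuous (fun y : 'rV[R]_n => enorm (y - x)).
Proof.
move=> y; apply: (@continuous_comp _ _ _ (fun y : 'rV[R]_n => y - x) (@enorm R n)).
  exact: subr_continuous.
exact: enorm_continuous.
Qed.

Definition eball r : set 'rV[R]_n := [set y | enorm y <= r].

Lemma closed_eball r : closed (eball r).
Proof.
apply: (@preimage_closed _ _ (@enorm R n) [set t | t <= r]) => //.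
by move=> x _; exact: enorm_continuous.
Qed.

Lemma compact_eball r : compact (eball r).
Proof.
apply: bounded_closed_compact; last exact: closed_eball.
exists r; split => [|M rM y /= yr]; first exact: num_real.
by rewrite (le_trans (normr_le_enorm _))// (le_trans yr)// ltW.
Qed.

Lemma compact_sub_eball (K : set 'rV[R]_n) : compact K ->
  exists2 r, 0 <= r & K `<=` eball r.
Proof.
move=> cK; have [->|/set0P K0] := eqVneq K set0; first by exists 0.
have [|c _ hc] := EVT_max_rV (f := @enorm R n) K0 cK.
  exact/continuous_subspaceT/enorm_continuous.
exists (enorm c); first exact: enorm_ge0.
by move=> y Ky; apply: hc; exact/mem_set.
Qed.

End Euclid.

(** * Continuity of pointwise combinations of real-valued functions *)

Section ContinuousReal.
Context {R : realType} {T : topologicalType}.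
Implicit Types f h : T -> R.

Lemma continuous_norm_comp f : continuous f -> continuous (fun p => `|f p|).
Proof. by move=> cf p; apply: cvg_norm; exact: cf. Qed.

Lemma continuousB_comp f h :
  continuous f -> continuous h -> continuous (fun p => f p - h p).
Proof. by move=> cf ch p; apply: cvgB; [exact: cf|exact: ch]. Qed.

Lemma continuousD_comp f h :
  continuous f -> continuous h -> continuous (fun p => f p + h p).
Proof. by move=> cf ch p; apply: cvgD; [exact: cf|exact: ch]. Qed.

Lemma continuousM_comp f h :
  continuous f -> continuous h -> continuous (fun p => f p * h p).
Proof. by move=> cf ch p; apply: cvgM; [exact: cf|exact: ch]. Qed.

Lemma continuous_clamp f (M : R) :
  continuous f -> continuous (fun p => Num.max (- M) (Num.min M (f p))).
Proof.
move=> cf p; apply: (@continuous_max _ _ (cst (- M)) (cst M \min f)).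
  exact: cst_continuous.
by apply: continuous_min; [exact: cst_continuous|exact: cf].
Qed.

End ContinuousReal.

(** * Borel measures with compact support *)

Section BorelMeasure.
Context {R : realType} {n : nat}.
Implicit Types (mu : {measure set (borelRn R n) -> \bar R}).
Implicit Types (f h : 'rV[R]_n -> R) (r : R).

Lemma measurable_open (U : set 'rV[R]_n) :
  open U -> measurable (U : set (borelRn R n)).
Proof. by move=> oU; exact: sub_sigma_algebra. Qed.

Lemma measurable_eball r : measurable (eball r : set (borelRn R n)).
Proof.
rewrite -[eball r]setCK; apply: measurableC; apply: measurable_open.
exact/closed_openC/closed_eball.
Qed.

Lemma continuous_measurable f :
  continuous f -> measurable_fun setT (f : borelRn R n -> R).
Proof.
move=> /continuousP cf; apply: (measurability _ (RGenOpens.measurableE R)).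
move=> _ [_ [a [b ->] <-]]; rewrite setTI; apply: measurable_open.
exact/cf/interval_open.
Qed.

(* Near-covering of [K] along the filter generated by the up-sets
   [set M | N `<=` M], for [N] null, glues the local null sets together. *)
Lemma compact_locally_null mu (K : set 'rV[R]_n) : compact K ->
  (forall x, K x -> exists U : set 'rV[R]_n, [/\ open U, U x & mu U = 0%E]) ->
  exists N : set (borelRn R n), [/\ measurable N, mu N = 0%E & K `<=` N].
Proof.
move=> /compact_near_coveringP cK Knull.
pose null : set (set (borelRn R n)) := [set N | measurable N /\ mu N = 0%E].
pose F := filter_from null (fun N => [set M | N `<=` M]).
have FF : Filter F.
  apply: filter_from_filter; first by exists set0; split=> //; rewrite measure0.
  move=> A B [mA A0] [mB B0]; exists (A `|` B); last by move=> M /=; rewrite subUset => -[].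
  by split; [exact: measurableU|rewrite measureU0].
have /cK : forall x, K x -> \forall x' \near x & M \near F, M x'.
  move=> x /Knull [U [oU Ux U0]]; exists (U, [set M | U `<=` M]) => /=.
    split; first exact: open_nbhs_nbhs.
    by exists U => //; split=> //; exact: measurable_open.
  by move=> [y M] /= [Uy]; apply.
by move=> [N [mN N0] KN]; exists N; split=> // x Kx; exact: (KN N).
Qed.

(** The support is defined point by point, so a covering argument is needed to see that its
    complement is null: the outside of the ball is covered by countably many compact shells, each of
    them null by [compact_locally_null]. *)
Lemma compactly_supported_eball mu : compactly_supported mu ->
  exists r, mu (~` eball r) = 0%E.
Proof.
move=> /compact_sub_eball [r _ supp_r]; exists (r + 1).
(* The closed inequality makes the shell compact, and starting at r + 1 keeps it off the support,
   which lies in [eball r]. *)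
pose C (k : nat) : set 'rV[R]_n := eball k%:R `&` [set y | r + 1 <= enorm y].
have C_null k :
    exists N : set (borelRn R n), [/\ measurable N, mu N = 0%E & C k `<=` N].
  apply: compact_locally_null => [|x [_ /= rx]].
    apply: compact_closedI; first exact: compact_eball.
    apply: (@preimage_closed _ _ (@enorm R n) [set t | r + 1 <= t]) => //.
    by move=> x _; exact: enorm_continuous.
  have : ~ msupport mu x by move=> /supp_r /=; rewrite /eball /=; lra.
  move=> /existsNP [U /not_implyP [oU /not_implyP [Ux /negP]]].
  rewrite -leNgt => U0; exists U; split=> //; apply/eqP.
  by rewrite eq_le U0 measure_ge0.
have [N hN] := choice C_null.
apply/eqP; rewrite eq_le measure_ge0 andbT.
have mN k : measurable (N k) by case: (hN k).
have <- : mu (\bigcup_k N k) = 0%E.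
  apply/eqP; rewrite eq_le measure_ge0 andbT.
  apply: (le_trans (measure_sigma_subadditive mu mN _ _)) => //.
    exact: bigcupT_measurable.
  by rewrite eseries0// => k _ _; case: (hN k).
apply: le_measure; rewrite ?inE.
- by apply: measurableC; exact: measurable_eball.
- exact: bigcupT_measurable.
move=> x /= /negP; rewrite -ltNge => rx.
have [k kx] : exists k, enorm x <= k%:R.
  by exists (Num.truncn (enorm x)).+1; exact/ltW/truncnS_gt.
exists k => //; case: (hN k) => _ _; apply; split=> //=; exact: ltW.
Qed.

(** * Integrals of continuous functions against a finite measure carried by a ball *)

Section Carried.
Variables (mu : {measure set (borelRn R n) -> \bar R}) (r : R).
Hypotheses (mufin : finite_nonzero mu) (mur : mu (~` eball r) = 0%E).

Lemma mass_gt0 : 0 < fine (mu setT).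
Proof. by case: mufin => m0 moo; rewrite fine_gt0 ?m0. Qed.

Lemma continuous_integrable_eball f : continuous f ->
  mu.-integrable (eball r : set (borelRn R n)) (EFin \o f).
Proof.
move=> cf; apply: measurable_bounded_integrable => //.
- exact: measurable_eball.
- apply: (@le_lt_trans _ _ (mu setT)); last by case: mufin.
  by apply: le_measure; rewrite ?inE//; exact: measurable_eball.
- by apply: measurable_funS (continuous_measurable cf).
have [->|/set0P K0] := eqVneq (eball r : set 'rV[R]_n) set0.
  by exists 0; split=> // M _ y [].
have [|c _ hc] := EVT_max_rV (f := fun x => `|f x|) K0 (@compact_eball _ _ r).
  exact/continuous_subspaceT/continuous_norm_comp.
exists `|f c|; split => [|M cM x /= xr]; first exact: num_real.
by rewrite (le_trans _ (ltW cM))// hc// mem_set.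
Qed.

(** A continuous function may be unbounded on R^n, but it is bounded on the ball, and the rest is
    null. *)
Lemma continuous_integrable f : continuous f ->
  mu.-integrable setT (EFin \o (f : borelRn R n -> R)).
Proof.
move=> cf; rewrite (negligible_integrable (N := (~` eball r : set (borelRn R n)))) => //.
- by rewrite setTD setCK; exact: continuous_integrable_eball.
- by apply: measurableC; exact: measurable_eball.
- by apply/measurable_EFinP; exact: continuous_measurable.
Qed.

Lemma Rintegral_eball f : continuous f ->
  \int[mu]_(y in setT) f y = \int[mu]_(y in eball r) f y.
Proof.
move=> cf; congr fine; rewrite (negligible_integral (N := (~` eball r : set (borelRn R n)))) //.
- by rewrite setTD setCK.
- by apply: measurableC; exact: measurable_eball.
- exact: continuous_integrable.
Qed.

Lemma le_Rintegral_carried f h : continuous f -> continuous h ->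
  (forall y, enorm y <= r -> f y <= h y) ->
  \int[mu]_(y in setT) f y <= \int[mu]_(y in setT) h y.
Proof.
move=> cf ch fh; rewrite !Rintegral_eball//; apply: le_Rintegral => //.
- exact: measurable_eball.
- exact: continuous_integrable_eball.
- exact: continuous_integrable_eball.
Qed.

Lemma dist_Rintegral_carried f h (e : R) : continuous f -> continuous h ->
  (forall y, enorm y <= r -> `|f y - h y| <= e) ->
  `|\int[mu]_(y in setT) f y - \int[mu]_(y in setT) h y|
    <= e * fine (mu setT).
Proof.
move=> cf ch fh; have cfh : continuous (fun y => f y - h y).
  exact: continuousB_comp.
rewrite -RintegralB//; [|exact: continuous_integrable..].
apply: (le_trans (le_normr_Rintegral _ _)) => //.
  exact: continuous_integrable.
rewrite -Rintegral_cst//; apply: le_Rintegral_carried => //.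
  exact: continuous_norm_comp.
by move=> y; apply: cst_continuous.
Qed.

(** A nonnegative function with zero integral vanishes almost everywhere, which would make [A]
    null. *)
Lemma Rintegral_gt0 f (A : set (borelRn R n)) : continuous f ->
  (forall y, 0 <= f y) -> measurable A -> (0 < mu A)%E ->
  (forall y, A y -> 0 < f y) -> 0 < \int[mu]_(y in setT) f y.
Proof.
move=> cf f0 mA A0 fA; rewrite lt0r Rintegral_ge0// andbT; apply/eqP => I0.
have mf : measurable_fun setT (EFin \o (f : borelRn R n -> R)).
  by apply/measurable_EFinP; exact: continuous_measurable.
have : (\int[mu]_y `|(EFin \o f) y| = 0)%E.
  have := continuous_integrable cf => /integrable_fin_num => /(_ measurableT) fin.
  rewrite -[RHS]/(0%:E) -I0 /Rintegral fineK//.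
  by apply: eq_integral => y _; rewrite gee0_abs// lee_fin.
move=> /(ae_eq_integral_abs mu measurableT mf) [N [mN N0 NA]].
move: A0; rewrite (subset_measure0 mA mN _ N0) ?ltxx// => y Ay.
by apply: NA => /= /(_ I) [fy]; move: (fA _ Ay); rewrite fy ltxx.
Qed.

End Carried.
End BorelMeasure.

(** * Continuity at a point of scalings and quotients *)

Section ContinuousAt.
Context {R : realType} {n : nat} {T : topologicalType}.
Implicit Types (f h : T -> R) (k : T -> 'rV[R]_n).

Lemma continuousZ_at f k p : {for p, continuous f} -> {for p, continuous k} ->
  {for p, continuous (fun p => f p *: k p)}.
Proof. by move=> cf ck; exact: (cvgZ cf ck). Qed.

Lemma continuous_div_at f h p : h p != 0 ->
  {for p, continuous f} -> {for p, continuous h} ->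
  {for p, continuous (fun p => f p / h p)}.
Proof. by move=> h0 cf ch; exact: (cvgM cf (cvgV h0 ch)). Qed.

End ContinuousAt.

(** * Continuity and monotonicity of the radial field *)

Section Radial.
Context {R : realType} {n : nat}.
Variable g : R -> R.
Hypothesis g0 : g 0 = 0.
Implicit Types a b x y u : 'rV[R]_n.

Lemma radialE y : radial g y = (g (enorm y) / enorm y) *: y.
Proof.
rewrite /radial; case: eqP => [->|_]; first by rewrite scaler0.
by rewrite scalerA.
Qed.

(** Since [0^-1 = 0], the case r = 0 amounts to g 0 = 0; the identities below thus need no case
    distinction at the origin. *)
Lemma divfK0 r : g r / r * r = g r.
Proof. by have [->|r0] := eqVneq r 0; [rewrite mulr0 g0|rewrite divfK]. Qed.

Lemma enorm_radial y : enorm (radial g y) = `|g (enorm y)|.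
Proof.
rewrite radialE enormZ -[in RHS]divfK0 [in RHS]normrM.
by rewrite [`|enorm y|]ger0_norm// enorm_ge0.
Qed.

(** Away from 0 the field is a continuous quotient times the identity; at 0 its length |g (|y|)|
    tends to g 0 = 0. *)
Lemma radial_continuous : continuous g -> continuous (@radial R n g).
Proof.
move=> cg y; have cgn : continuous (fun z : 'rV[R]_n => g (enorm z)).
  move=> z; apply: (@continuous_comp _ _ _ (@enorm R n) g).
    exact: enorm_continuous.
  exact: cg.
have [->|y0] := eqVneq y 0.
  rewrite /continuous_at [radial g 0](_ : _ = 0); last by rewrite /radial eqxx.
  apply/(cvgr0Pnorm_le (FF := nbhs_filter (0 : 'rV[R]_n))) => e e0.
  have := cgn 0; rewrite /continuous_at enorm0 g0 => /cvgr0Pnorm_le /(_ _ e0).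
  apply: filterS => z ze.
  by rewrite (le_trans (normr_le_enorm _))// enorm_radial.
rewrite (_ : radial g = fun z => (g (enorm z) / enorm z) *: z); last first.
  by apply/funext => z; rewrite radialE.
apply: (@continuousZ_at _ _ _ (fun z => g (enorm z) / enorm z) id) => //.
apply: (@continuous_div_at _ _ (fun z => g (enorm z))).
- by rewrite enorm_eq0.
- exact: cgn.
- exact: enorm_continuous.
Qed.

Lemma dot_radialB a b : dot (radial g a - radial g b) (a - b) =
  (g (enorm a) - g (enorm b)) * (enorm a - enorm b) +
  (g (enorm a) / enorm a + g (enorm b) / enorm b) *
    (enorm a * enorm b - dot a b).
Proof.
rewrite !radialE !(dotBl, dotBr, dotZl) (dotC b a) -!sqr_enorm.
(* Writing g r as (g r / r) r turns both sides into polynomials in the slopes, the norms and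
   [dot a b]. *)
rewrite -[in X in X * (_ - _)](divfK0 (enorm a)).
rewrite -[in X in X * (_ - _)](divfK0 (enorm b)).
ring.
Qed.

(** Serves the equality case of Cauchy-Schwarz: when [dot a b] reaches the product of the norms, |b|
    a = |a| b. *)
Lemma sqr_enorm_cross a b : enorm (enorm b *: a - enorm a *: b) ^+ 2 =
  2 * (enorm a * enorm b) * (enorm a * enorm b - dot a b).
Proof.
rewrite sqr_enorm !(dotBl, dotBr, dotZl, dotZr) -!sqr_enorm (dotC b a); ring.
Qed.

Hypothesis g_incr : increasing g.

Lemma increasing_ge0 r : 0 <= r -> 0 <= g r.
Proof. by move=> r0; rewrite -g0 g_incr// in_itv/= ?lexx ?r0. Qed.

Lemma increasing_dist_ge0 r s :
  0 <= r -> 0 <= s -> 0 <= (g r - g s) * (r - s).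
Proof.
move=> r0 s0; have [rs|/ltW rs] := leP r s.
  by apply: mulr_le0; rewrite subr_le0// g_incr// in_itv/= ?r0 ?s0.
by apply: mulr_ge0; rewrite subr_ge0// g_incr// in_itv/= ?r0 ?s0.
Qed.

Lemma increasing_slope_ge0 r : 0 <= r -> 0 <= g r / r.
Proof. by move=> r0; rewrite divr_ge0// increasing_ge0. Qed.

Lemma dot_radialB_ge0 a b : 0 <= dot (radial g a - radial g b) (a - b).
Proof.
rewrite dot_radialB; apply: addr_ge0.
  by apply: increasing_dist_ge0; exact: enorm_ge0.
apply: mulr_ge0; last by rewrite subr_ge0 dot_le_enorm.
by apply: addr_ge0; apply: increasing_slope_ge0; exact: enorm_ge0.
Qed.

(** If the norms differ, the first summand of [dot_radialB] is positive. If they agree, it vanishes,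
    and |a - b|^2 = 2 (|a| |b| - <a, b>) makes the second one positive. *)
Lemma dot_radialB_gt0_incr a b : strictly_increasing g -> a != b ->
  0 < dot (radial g a - radial g b) (a - b).
Proof.
move=> g_sincr ab; rewrite dot_radialB.
have g_gt0 r : 0 < r -> 0 < g r.
  by move=> r0; rewrite -g0 g_sincr// in_itv/= ?lexx ?(ltW r0).
have p_le : 0 <= (g (enorm a) / enorm a + g (enorm b) / enorm b) *
    (enorm a * enorm b - dot a b).
  apply: mulr_ge0; last by rewrite subr_ge0 dot_le_enorm.
  by apply: addr_ge0; apply: increasing_slope_ge0; exact: enorm_ge0.
have [lab|lab|eab] := ltgtP (enorm a) (enorm b).
- rewrite ltr_pwDl// nmulr_rgt0 subr_lt0// g_sincr// in_itv/= ?enorm_ge0//.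
- rewrite ltr_pwDl// pmulr_rgt0 subr_gt0// g_sincr// in_itv/= ?enorm_ge0//.
have b0 : 0 < enorm b.
  rewrite enorm_gt0; apply: contraNneq ab => b0.
  by rewrite b0 -enorm_eq0 eab b0 enorm0.
rewrite eab subrr mul0r add0r mulr_gt0//.
  by rewrite addr_gt0// divr_gt0// g_gt0.
have : 0 < enorm (a - b) ^+ 2 by rewrite exprn_gt0// enorm_gt0 subr_eq0.
rewrite sqr_enorm !(dotBl, dotBr) -!sqr_enorm eab (dotC b a); lra.
Qed.

(* Equality in Cauchy-Schwarz for x + y and x' + y would put y on the line
   through -x and -x'. *)
Lemma dot_radialB_gt0_offline x x' y : (forall r, 0 < r -> 0 < g r) ->
  x != x' -> ~ affine_line (- x) (x - x') y ->
  0 < dot (radial g (x + y) - radial g (x' + y)) (x - x').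
Proof.
move=> g_gt0 xx' yline.
have -> : x - x' = (x + y) - (x' + y) by rewrite opprD addrACA subrr addr0.
set a := x + y; set b := x' + y.
have ab : a != b by apply: contra_neq xx' => /addIr.
rewrite dot_radialB ltr_wpDl//.
  by apply: increasing_dist_ge0; exact: enorm_ge0.
have p_lt : 0 < enorm a * enorm b - dot a b.
  rewrite subr_gt0 lt_neqAle dot_le_enorm andbT; apply/eqP => pab.
  have /eqP := sqr_enorm_cross a b; rewrite pab subrr mulr0 sqrf_eq0 enorm_eq0.
  rewrite subr_eq0 => /eqP eqab.
  (* Equal norms would give a = b: either both vectors vanish or the common norm cancels. *)
  have [nab|nab] := eqVneq (enorm a) (enorm b).
    move: eqab; rewrite nab; have [b0|b0] := eqVneq (enorm b) 0.
      move: nab; rewrite b0 => /eqP; rewrite enorm_eq0 => /eqP a0.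
      move/eqP : b0; rewrite enorm_eq0 => /eqP b0.
      by move: ab; rewrite a0 b0 eqxx.
    by move=> /(scalerI b0) ab'; move: ab; rewrite ab' eqxx.
  (* The parameter comes from solving |b| (x + y) = |a| (x' + y) for y. *)
  apply: yline; exists (enorm a / (enorm a - enorm b)) => //.
  have d0 : enorm a - enorm b != 0 by rewrite subr_eq0.
  apply: (scalerI d0); rewrite scalerDr scalerA mulrCA mulfV// mulr1.
  apply/rowP => i; move/rowP : eqab => /(_ i).
  by move: (enorm a) (enorm b) => A B; rewrite !mxE; lra.
apply: mulr_gt0 => //; apply: ltr_pwDl; last first.
  by apply: increasing_slope_ge0; exact: enorm_ge0.
have a0 : 0 < enorm a.
  rewrite enorm_gt0; apply: contraTneq p_lt => ->.
  by rewrite enorm0 dot0l mul0r subrr ltxx.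
by rewrite divr_gt0// g_gt0.
Qed.

End Radial.

(** * Primitives of a continuous function on the line *)

Section Antiderivative.
Context {R : realType}.
Notation lambda := (@lebesgue_measure R).

(* The base point -1 makes the primitive differentiable at 0 too. *)
Definition primitive (g : R -> R) (r : R) : R :=
  \int[lambda]_(s in `[-1, r]) g s.

Variable g : R -> R.
Hypothesis cg : continuous g.

Lemma continuous_integrable_itv (a b : R) :
  lambda.-integrable `[a, b] (EFin \o g).
Proof.
apply: continuous_compact_integrable; first exact: segment_compact.
exact: continuous_subspaceT.
Qed.

(** The fundamental theorem of calculus on [[-1, r + 1]], where r is an interior point. *)
Lemma is_derive_primitive (r : R) : -1 < r -> is_derive r 1 (primitive g) (g r).
Proof.
move=> r1; have rr1 : r < r + 1 by rewrite ltrDl.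
have [d1 d2] := continuous_FTC1_closed rr1
  (continuous_integrable_itv (-1) (r + 1)) r1 (@cg r).
by rewrite -d2 derive1E; exact: DeriveDef.
Qed.

Lemma primitive_mvt (r s : R) : 0 <= r -> r <= s ->
  exists c, [/\ r <= c, c <= s & primitive g s - primitive g r = g c * (s - r)].
Proof.
move=> r0 rs; have [|||c crs ->] := @MVT_segment _ (primitive g) g r s => //.
- move=> x; rewrite in_itv/= => /andP[rx _]; apply: is_derive_primitive; lra.
- apply: derivable_within_continuous => x; rewrite in_itv/= => /andP[rx _].
  by apply: ex_derive; apply: is_derive_primitive; lra.
by exists c; move: crs; rewrite in_itv/= => /andP[-> ->].
Qed.

(** A mean value theorem that assumes no order between r and s, since the norm may grow or shrink
    under a displacement. *)
Lemma primitive_near_mvt (r s : R) : 0 <= r -> 0 <= s ->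
  exists c, [/\ 0 <= c, `|c - r| <= `|s - r| &
    primitive g s - primitive g r = g c * (s - r)].
Proof.
move=> r0 s0; have [rs|/ltW sr] := leP r s.
  have [c [rc cs ->]] := primitive_mvt r0 rs; exists c.
  by split=> //; [lra|rewrite !ger0_norm; lra].
have [c [sc cr e]] := primitive_mvt s0 sr; exists c; split; first lra.
  by rewrite !ler0_norm; lra.
by rewrite -opprB e -mulrN opprB.
Qed.

Lemma primitive_itv (r : R) : 0 <= r ->
  primitive g r = primitive g 0 + \int[lambda]_(s in `[0, r]) g s.
Proof.
move=> r0; rewrite [X in _ + X](_ : _ = \int[lambda]_(s in `]0, r]) g s).
  rewrite -(@Rintegral_itvB _ g (BLeft (-1)) (BRight r) 0).
  - by rewrite addrC subrK.
  - exact: continuous_integrable_itv.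
  - by rewrite bnd_simp; lra.
  - by rewrite bnd_simp.
rewrite Rintegral_itv_obnd_cbnd//.
apply: (integrableS _ _ _ (continuous_integrable_itv 0 r)) => //.
exact: subset_itv_oc_cc.
Qed.

(** Strict differentiability: the base point r moves along with s, as uniformity in y will require
    in [potential_expand]. The difference quotient is a value of g close to c, hence close to g
    r. *)
Lemma primitive_strict_diff (c e : R) : 0 < e ->
  exists2 d : R, 0 < d & forall r s : R, 0 <= r -> 0 <= s ->
    `|r - c| <= d -> `|s - c| <= d ->
    `|primitive g s - primitive g r - g r * (s - r)| <= e * `|s - r|.
Proof.
move=> e0; have e2 : 0 < e / 2 by rewrite divr_gt0.
have /cvgrPdist_le /(_ _ e2) := @cg c.
(* The intermediate point x satisfies |x - r| <= |s - r| <= d / 2, hence |x - c| <= 3 d / 4 < d. *)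
move=> /nbhs_ballP [d /= d0 hd]; exists (d / 4); first by rewrite divr_gt0.
have near_g x : `|x - c| < d -> `|g c - g x| <= e / 2.
  by move=> xc; apply: hd; rewrite /ball/= distrC.
move=> r s r0 s0 rc sc; have [x [x0 xr ->]] := primitive_near_mvt r0 s0.
rewrite -mulrBl normrM ler_wpM2r// (splitr e).
rewrite (_ : g x - g r = (g c - g r) - (g c - g x)); last by ring.
apply: (le_trans (ler_normB _ _)); apply: lerD; apply: near_g; first lra.
have := ler_normD (x - r) (r - c); have := ler_normB (s - c) (r - c).
rewrite (_ : x - r + (r - c) = x - c); last by ring.
rewrite (_ : s - c - (r - c) = s - r); last by ring.
lra.
Qed.

End Antiderivative.

(** The line is the zero set of the distance from y to its orthogonal projection on it. Closedness
    makes the complement of the line Borel. *)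
Lemma closed_affine_line {R : realType} {n : nat} (a b : 'rV[R]_n) :
  b != 0 -> closed (affine_line a b).
Proof.
rewrite -enorm_gt0 => b0.
pose f y := enorm (y - a - (dot (y - a) b / enorm b ^+ 2) *: b).
have -> : affine_line a b = f @^-1` [set t | t <= 0].
  apply/seteqP; split => [_ [t _ <-]|y] /=.
    rewrite /f [a + _ - a](_ : _ = t *: b); last by rewrite addrAC subrr add0r.
    rewrite dotZl -sqr_enorm mulfK ?expf_neq0 ?gt_eqF//.
    by rewrite subrr enorm0.
  rewrite le_eqVlt ltNge enorm_ge0 orbF enorm_eq0 subr_eq0 => /eqP yE.
  by exists (dot (y - a) b / enorm b ^+ 2) => //; rewrite -yE addrC subrK.
have cq : continuous (fun y : 'rV[R]_n => (dot (y - a) b / enorm b ^+ 2) *: b).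
  move=> z; apply: (@continuousZ_at _ _ _
    (fun y : 'rV[R]_n => dot (y - a) b / enorm b ^+ 2) (cst b)); last exact: cst_continuous.
  apply: (@continuousM_comp _ _ (fun y : 'rV[R]_n => dot (y - a) b)).
    by apply: dot_continuous; [exact: subr_continuous|exact: cst_continuous].
  exact: cst_continuous.
apply: (@preimage_closed _ _ f [set t | t <= 0]) => //.
by move=> y _; exact: (continuous_comp (continuousB (@subr_continuous R n a y) (@cq y))
  (@enorm_continuous R n _)).
Qed.

(** * The potential and its first-order expansion *)

Section Potential.
Context {R : realType} {n : nat}.
Variable g : R -> R.
Hypotheses (cg : continuous g) (g0 : g 0 = 0).
Implicit Types (y z u : 'rV[R]_n) (e t : R).

Definition potential y : R := primitive g (enorm y).

Lemma potential_continuous : continuous potential.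
Proof.
move=> z; apply: (@continuous_comp _ _ _ (@enorm R n) (primitive g)).
  exact: enorm_continuous.
apply: differentiable_continuous; apply/derivable1_diffP/ex_derive.
by apply: is_derive_primitive => //; rewrite (lt_le_trans _ (enorm_ge0 z)).
Qed.

(* With a = |y|, b = |y + t u|, p = <y, u>:
   2 (a (b - a) - t p) = t^2 |u|^2 - (b - a)^2, which lies in [0, t^2 |u|^2]. *)
Lemma enorm_expand y u t : y != 0 ->
  `|enorm (y + t *: u) - enorm y - t * (dot y u / enorm y)|
     <= t ^+ 2 * enorm u ^+ 2 / enorm y.
Proof.
rewrite -enorm_gt0 => a0.
have : enorm (y + t *: u) ^+ 2 =
    enorm y ^+ 2 + 2 * t * dot y u + t ^+ 2 * enorm u ^+ 2.
  rewrite sqr_enorm !(dotDl, dotDr, dotZl, dotZr) -!sqr_enorm (dotC u y); ring.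
have : (enorm (y + t *: u) - enorm y) ^+ 2 <= t ^+ 2 * enorm u ^+ 2.
  rewrite -[leLHS]real_normK ?num_real// -[t ^+ 2]real_normK ?num_real//.
  rewrite -exprMn -enormZ lerXn2r ?nnegrE ?enorm_ge0//.
  by rewrite (le_trans (ler_dist_enorm _ _))// addrAC subrr add0r.
move: a0; set a := enorm y; set b := enorm (y + _); set p := dot y u => a0 h1 h2.
have -> : b - a - t * (p / a) = (a * (b - a) - t * p) / a by field; rewrite gt_eqF.
rewrite ler_norml -mulNr !ler_pM2r ?invr_gt0//.
have := sqr_ge0 (b - a) => ?; apply/andP; split; nra.
Qed.

Lemma enorm_near z e : 0 < e -> \forall y \near z, enorm (y - z) <= e.
Proof.
move=> e0; have /cvgr0Pnorm_le/(_ _ e0) : enorm (y - z) @[y --> z] --> 0.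
  rewrite -[X in _ --> X](@enorm0 R n) -[in X in _ --> X](subrr z).
  exact: enorm_subr_continuous.
by apply: filterS => y; rewrite ger0_norm// enorm_ge0.
Qed.

Lemma dot_radial y u : dot (radial g y) u = g (enorm y) * (dot y u / enorm y).
Proof. by rewrite radialE dotZl mulrAC mulrA. Qed.

(* The gradient of the potential is the radial field, locally uniformly; at
   z = 0 this uses g 0 = 0. *)
Lemma potential_expand z u e : 0 < e ->
  \forall t \near 0^'+ & y \near z,
   `|potential (y + t *: u) - potential y - t * dot (radial g y) u| <= e * t.
Proof.
move=> e0; set U := enorm u; have U0 : 0 <= U by exact: enorm_ge0.
(* The + 1 keeps the divisor positive when u = 0; the 4 makes the product of this number with 2 t U
   at most e t / 2. *)
have e10 : 0 < e / (4 * (U + 1)) by rewrite divr_gt0//; lra.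
have [d d0 hd] := primitive_strict_diff cg (enorm z) e10.
(* The error is that of the primitive between |y| and |y + t u|, plus [g (enorm y)] times that of
   the norm. Strict differentiability bounds the first; [rest] bounds the second by e t / 2. *)
suff rest : \forall t \near 0^'+ & y \near z,
    `|g (enorm y)| * `|enorm (y + t *: u) - enorm y - t * (dot y u / enorm y)|
      <= e / 2 * t.
  have [[/= A B] [A0 Bz] AB] := rest.
  near=> t y => /=.
  have t0 : 0 < t by near: t; exact: nbhs_right_gt.
  have yz : enorm (y - z) <= d / 2.
    by near: y; apply: enorm_near; rewrite divr_gt0.
  have tU : t * U <= d / 2.
    have : t < d / (2 * (U + 1)).
      by near: t; apply: nbhs_right_lt; rewrite divr_gt0//; lra.
    by rewrite ltr_pdivlMr; nra.
  have r : `|g (enorm y)| *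
      `|enorm (y + t *: u) - enorm y - t * (dot y u / enorm y)| <= e / 2 * t.
    by apply: (AB (t, y)); split; [exact: (near A0 t)|exact: (near Bz y)].
  have ba : `|enorm (y + t *: u) - enorm y| <= t * U.
    rewrite (le_trans (ler_dist_enorm _ _))// addrAC subrr add0r enormZ.
    by rewrite gtr0_norm.
  have yz' : `|enorm y - enorm z| <= d / 2 by exact: le_trans (ler_dist_enorm _ _) _.
  have /hd := enorm_ge0 y => /(_ _ (enorm_ge0 (y + t *: u))).
  move=> /(_ _ _)/le_trans hP.
  rewrite /= dot_radial /potential.
  rewrite [X in `|X|](_ : _ = (primitive g (enorm (y + t *: u)) - primitive g (enorm y)
      - g (enorm y) * (enorm (y + t *: u) - enorm y)) + g (enorm y) *
     (enorm (y + t *: u) - enorm y - t * (dot y u / enorm y))); last by ring.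
  apply: (le_trans (ler_normD _ _)); rewrite [X in _ + X]normrM.
  apply: (@le_trans _ _ (e / 2 * t + e / 2 * t)); last by lra.
  apply: lerD => //; apply: hP; first lra.
    have := ler_normD (enorm (y + t *: u) - enorm y) (enorm y - enorm z).
    by rewrite addrA subrK; lra.
  apply: (@le_trans _ _ (e / (4 * (U + 1)) * (t * U))).
    by rewrite ler_wpM2l// ltW.
  rewrite mulrAC ler_pdivrMr; last lra.
  have := mulr_ge0 (ltW e0) (ltW t0); nra.
(* At the origin the norm is not differentiable: its increment and its linear term are each only
   bounded by t U, and the smallness of g (|y|) does the work. *)
have [->|z0] := eqVneq z 0.
  near=> t y => /=.
  have t0 : 0 < t by near: t; exact: nbhs_right_gt.
  have gy : `|g (enorm y)| <= e / (4 * (U + 1)).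
    near: y.
    have cgn : {for 0, continuous (fun y : 'rV[R]_n => g (enorm y))}.
      apply: (@continuous_comp _ _ _ (@enorm R n) g); last exact: cg.
      exact: enorm_continuous.
    move: cgn; rewrite /prop_for /continuous_at/= enorm0 g0.
    by move=> /cvgr0Pnorm_le /(_ _ e10).
  have ba : `|enorm (y + t *: u) - enorm y| <= t * U.
    rewrite (le_trans (ler_dist_enorm _ _))// addrAC subrr add0r enormZ.
    by rewrite gtr0_norm.
  have q : `|t * (dot y u / enorm y)| <= t * U.
    rewrite normrM gtr0_norm// ler_wpM2l ?(ltW t0)// normrM normfV.
    rewrite [`|enorm y|]ger0_norm ?enorm_ge0//.
    have [->|y0] := eqVneq y 0; first by rewrite dot0l normr0 mul0r.
    by rewrite ler_pdivrMr ?enorm_gt0// mulrC normr_dot_le.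
  apply: (@le_trans _ _ (e / (4 * (U + 1)) * (t * U + t * U))).
    apply: ler_pM => //; apply: (le_trans (ler_normB _ _)); exact: lerD.
  rewrite mulrAC ler_pdivrMr; last lra.
  have := mulr_ge0 (ltW e0) (ltW t0); nra.
(* Away from the origin the error of the norm is quadratic in t, while |y| >= |z| / 2 and |g (|y|)|
   <= M. *)
rewrite -enorm_gt0 in z0; set M := `|g (enorm z)| + 1.
have M0 : 0 < M by rewrite ltr_wpDl.
near=> t y => /=.
have t0 : 0 < t by near: t; exact: nbhs_right_gt.
have gy : `|g (enorm y)| <= M.
  near: y; have cgn : {for z, continuous (fun y : 'rV[R]_n => `|g (enorm y)|)}.
    apply: (@continuous_comp _ _ _ (@enorm R n) (fun r => `|g r|)).
      exact: enorm_continuous.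
    by move: (enorm z); exact: continuous_norm_comp.
  apply: (cvgr_le _ cgn); rewrite /M; lra.
have yz : enorm z / 2 <= enorm y.
  have : enorm (y - z) <= enorm z / 2.
    by near: y; apply: enorm_near; rewrite divr_gt0.
  have := ler_enormD (z - y) y; rewrite subrK -(enormN (z - y)) opprB; lra.
have y0 : 0 < enorm y by lra.
(* This threshold on t brings M t^2 U^2 / |y| below e t / 2; the + 1 covers u = 0. *)
have ty : t * (M * U ^+ 2 * 4 + 1) <= e * enorm z.
  rewrite -ler_pdivlMr; last by have := sqr_ge0 U; nra.
  near: t; apply: nbhs_right_le; rewrite divr_gt0 ?mulr_gt0//.
  by have := sqr_ge0 U; nra.
rewrite enorm_gt0 in y0; have h := enorm_expand u t y0.
apply: (@le_trans _ _ (M * (t ^+ 2 * U ^+ 2 / enorm y))); first exact: ler_pM.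
rewrite -enorm_gt0 in y0; rewrite mulrA ler_pdivrMr//.
apply: (@le_trans _ _ (e / 2 * t * (enorm z / 2))); last first.
  by rewrite ler_wpM2l// mulr_ge0 ?(ltW t0)// divr_ge0// ltW.
have := ler_wpM2l (ltW t0) ty; nra.
Unshelve. all: by end_near.
Qed.

End Potential.

(** * Estimates uniform over a ball *)

Section Uniformity.
Context {R : realType} {n : nat}.
Implicit Types (x y u : 'rV[R]_n) (r : R).

Lemma near_eball (I : Type) (F : set_system I) (P : I -> 'rV[R]_n -> Prop) r :
  Filter F -> (forall y, enorm y <= r -> \forall y' \near y & i \near F, P i y') ->
  \forall i \near F, forall y, enorm y <= r -> P i y.
Proof.
by move=> FF /((compact_near_coveringP _).1 (@compact_eball R n r) I F P FF).
Qed.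

(** Near each (x, y), both F (x', y') and F (x, y') are within e / 2 of F (x, y); compactness of the
    ball then provides one neighbourhood of x valid for all y. *)
Lemma near_uniform (F : 'rV[R]_n * 'rV[R]_n -> R) r x (e : R) :
  continuous F -> 0 < e ->
  \forall x' \near x, forall y, enorm y <= r -> `|F (x', y) - F (x, y)| <= e.
Proof.
move=> cF e0; apply: (near_eball (F := nbhs x)
  (P := fun x' y => `|F (x', y) - F (x, y)| <= e)) => y _.
have e2 : 0 < e / 2 by rewrite divr_gt0.
have /cvgrPdist_le /(_ _ e2) [[A B] [/= Ax By] AB] := @cF (x, y).
exists (B, A) => //= -[y' x'] /= [By' Ax'].
have h1 := AB (x', y') (conj Ax' By').
have h2 := AB (x, y') (conj (nbhs_singleton Ax) By').
rewrite (_ : F (x', y') - _ = (F (x, y) - F (x, y')) - (F (x, y) - F (x', y'))).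
  by rewrite (splitr e) (le_trans (ler_normB _ _))// lerD.
by ring.
Qed.

Lemma continuous_addl x : continuous (fun y => x + y).
Proof.
by move=> y; apply: (@continuousD _ _ _ (cst x) id) => //; exact: cst_continuous.
Qed.

Lemma continuous_shift (T : topologicalType) (f : 'rV[R]_n -> T) x :
  continuous f -> continuous (fun y => f (x + y)).
Proof.
move=> cf y; apply: (@continuous_comp _ _ _ (fun y => x + y) f).
  exact: continuous_addl.
exact: cf.
Qed.

Lemma near_shift (f : 'rV[R]_n -> R) r x (e : R) : continuous f -> 0 < e ->
  \forall x' \near x, forall y, enorm y <= r -> `|f (x' + y) - f (x + y)| <= e.
Proof.
move=> cf; apply: (@near_uniform (fun p => f (p.1 + p.2))) => p.
apply: (@continuous_comp _ _ _ (fun p : 'rV[R]_n * 'rV[R]_n => p.1 + p.2) f).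
  exact: add_continuous.
exact: cf.
Qed.

End Uniformity.

(** * The field of a fixed measure: existence of a zero and strict monotonicity *)

Section Field.
Context {R : realType} {n : nat}.
Variable g : R -> R.
Hypotheses (cg : continuous g) (g0 : g 0 = 0).
Implicit Types x y u : 'rV[R]_n.

Lemma radial_dot_continuous x u :
  continuous (fun y => dot (radial g (x + y)) u).
Proof.
apply: dot_continuous; last exact: cst_continuous.
by apply: continuous_shift; exact: radial_continuous.
Qed.

Section FixedMeasure.
Variables (mu : {measure set (borelRn R n) -> \bar R}) (r : R).
Hypotheses (mufin : finite_nonzero mu) (mur : mu (~` eball r) = 0%E).

Lemma Rintegral_dot (F : 'rV[R]_n -> 'rV[R]_n) u : continuous F ->
  dot (\row_i \int[mu]_(y in setT) F y ord0 i) u =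
  \int[mu]_(y in setT) dot (F y) u.
Proof.
move=> cF; pose f i y : R := F y ord0 i * u ord0 i.
have cf i : continuous (f i).
  apply: continuousM_comp; last exact: cst_continuous.
  exact: continuous_coord_comp.
have -> : dot (\row_i \int[mu]_(y in setT) F y ord0 i) u =
    \sum_i \int[mu]_(y in setT) f i y.
  apply: eq_bigr => i _; rewrite mxE RintegralZr//.
  by apply: (continuous_integrable mufin mur); exact: continuous_coord_comp.
(* Continuity travels with the induction because [RintegralD] asks for integrability of both
   summands. *)
suff h (s : seq 'I_n) : continuous (fun y => \sum_(i <- s) f i y) /\
    \sum_(i <- s) \int[mu]_(y in setT) f i y =
    \int[mu]_(y in setT) (\sum_(i <- s) f i y) by exact: (h _).2.
elim: s => [|i s [cs ihs]].
  rewrite big_nil (_ : (fun y => _) = cst 0); last first.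
    by apply/funext => y; rewrite big_nil.
  by rewrite Rintegral_cst// mul0r; split=> //; exact: cst_continuous.
have E : (fun y => \sum_(j <- i :: s) f j y) =
    (fun y => f i y + \sum_(j <- s) f j y) by apply/funext => y; rewrite big_cons.
rewrite big_cons E ihs RintegralD//; first last.
- exact: (continuous_integrable mufin mur).
- exact: (continuous_integrable mufin mur).
by split=> //; exact: continuousD_comp.
Qed.

(** Pairing with a vector turns questions about the field into questions about scalar integrals. *)
Lemma dot_vfield x u :
  dot (vfield g mu x) u = \int[mu]_(y in setT) dot (radial g (x + y)) u.
Proof.
apply: (@Rintegral_dot (fun y => radial g (x + y))).
by apply: continuous_shift; exact: radial_continuous.
Qed.

Lemma dot_vfieldB x x' u : dot (vfield g mu x - vfield g mu x') u =
  \int[mu]_(y in setT) dot (radial g (x + y) - radial g (x' + y)) u.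
Proof.
rewrite dotBl !dot_vfield -RintegralB//.
- by apply: eq_Rintegral => y _; rewrite dotBl.
- by apply: (continuous_integrable mufin mur); exact: radial_dot_continuous.
- by apply: (continuous_integrable mufin mur); exact: radial_dot_continuous.
Qed.

(** Coercivity is asked of the primitive itself, so that a divergent integral of g and an increasing
    g with g 1 > 0 can both supply it. *)
Lemma vfield_zero_of_coercive :
  (forall M : R, exists2 rho : R, 0 <= rho & forall s : R, rho <= s -> M <= primitive g s) ->
  exists x, vfield g mu x = 0.
Proof.
move=> coercive; pose m := fine (mu setT).
have m0 : 0 < m by exact: mass_gt0.
have cpot x : continuous (fun y => potential g (x + y)).
  by apply: continuous_shift; exact: potential_continuous.
pose E x := \int[mu]_(y in setT) potential g (x + y).
have cE : continuous E.
  move=> x; apply/(cvgrPdist_le (FF := nbhs_filter x)) => e e0.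
  have em : 0 < e / m by rewrite divr_gt0.
  have := near_shift r x (potential_continuous cg) em.
  apply: filterS => x' h; rewrite distrC.
  rewrite (le_trans (dist_Rintegral_carried mufin mur _ _ h))//.
  by rewrite divfK ?gt_eqF.
(* Beyond the radius rho + |r|, every y in the carrier has |x + y| >= rho, so E x >= E 0 + m and a
   minimum over the ball is global. The absolute value keeps the radius nonnegative, hence 0 in the
   ball. *)
have [rho rho0 hrho] := coercive (E 0 / m + 1).
have [x0 Ex0] : exists x0, forall x, E x0 <= E x.
  have B0 : eball (rho + `|r|) (0 : 'rV[R]_n).
    by rewrite /eball/= enorm0 addr_ge0.
  have [|||x0 _ hx0] := @EVT_min_rV R n E (eball (rho + `|r|)).
  - by exists 0.
  - exact: compact_eball.
  - exact: continuous_subspaceT.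
  exists x0 => x; have [xB|xB] := leP (enorm x) (rho + `|r|).
    by apply: hx0; exact/mem_set.
  apply: (@le_trans _ _ (E 0)); first by apply: hx0; exact/mem_set.
  apply: (@le_trans _ _ ((E 0 / m + 1) * m)).
    by rewrite mulrDl divfK ?gt_eqF// lerDl mul1r ltW.
  rewrite -Rintegral_cst//; apply: (le_Rintegral_carried mufin mur) => //.
    exact: cst_continuous.
  move=> y yr; apply: hrho.
  have := ler_enormD (x + y) (- y); rewrite addrK enormN.
  by have := ler_norm r; lra.
(* If V does not vanish at the minimizer, a small step along - V lowers E by t |V|^2 up to a smaller
   error, which is absurd. *)
exists x0; apply/eqP; apply: contraT => V0.
set V := vfield g mu x0 in V0 *; pose D := enorm V ^+ 2.
have D0 : 0 < D by rewrite exprn_gt0// enorm_gt0.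
(* With this e the integrated error [e * t * m] is t D / 2, half of the linear decrease t D. *)
pose e := D / (2 * m); have e0 : 0 < e by rewrite divr_gt0// mulr_gt0.
(* The expansion is made uniform over the carrier and then integrated as it stands, in place of
   differentiating under the integral. *)
have : \forall t \near 0^'+, forall y, enorm y <= r ->
    `|potential g (x0 + t *: - V + y) - potential g (x0 + y) -
      t * dot (radial g (x0 + y)) (- V)| <= e * t.
  apply: near_eball => y _.
  have [[A B] [/= A0 By] AB] := potential_expand cg g0 (x0 + y) (- V) e0.
  exists ([set y' | B (x0 + y')], A).
    by split=> //=; exact: (continuous_addl By).
  by move=> [y' t] /= [By' At]; rewrite (addrAC x0); exact: (AB (t, x0 + y')).
move=> h; have [t [t0 ht]] := filter_ex (filterI (nbhs_right_gt (0 : R)) h).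
have cV : continuous (fun y => t * dot (radial g (x0 + y)) (- V)).
  by apply: continuousM_comp; [exact: cst_continuous|exact: radial_dot_continuous].
set x1 := x0 + t *: - V in ht.
have key : `|E x1 - E x0 - t * dot V (- V)| <= e * t * m.
  rewrite /V dot_vfield -RintegralZl//; last first.
    by apply: (continuous_integrable mufin mur); exact: radial_dot_continuous.
  rewrite -RintegralB//; [|exact: (continuous_integrable mufin mur)..].
  apply: (dist_Rintegral_carried mufin mur) => //.
  by apply: continuousB_comp; exact: cpot.
have et : e * t * m = t * D / 2 by rewrite /e; field; rewrite gt_eqF.
move: key (Ex0 x1) (mulr_gt0 t0 D0); rewrite et dotNr -sqr_enorm -/D.
by move: (E x1) (E x0) => p q; rewrite ler_norml mulrN opprK => /andP[_]; lra.
Qed.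

Lemma vfield_monotone x x' : increasing g ->
  0 <= dot (vfield g mu x - vfield g mu x') (x - x').
Proof.
move=> g_incr; rewrite dot_vfieldB; apply: Rintegral_ge0 => y _.
have -> : x - x' = (x + y) - (x' + y) by rewrite opprD addrACA subrr addr0.
exact: dot_radialB_ge0.
Qed.

(** The integrand is nonnegative. Under (i) it is positive everywhere; under (ii) it is positive off
    the line through - x in the direction x - x', a set of positive measure. *)
Lemma vfield_strictly_monotone x x' :
  strictly_increasing g \/ uniq_cond_ii g mu -> x != x' ->
  0 < dot (vfield g mu x - vfield g mu x') (x - x').
Proof.
move=> hyp xx'.
have g_incr : increasing g.
  case: hyp => [g_sincr|[]//] s t s0 t0; rewrite le_eqVlt => /predU1P[->//|st].
  exact/ltW/g_sincr.
have E y : x - x' = (x + y) - (x' + y) by rewrite opprD addrACA subrr addr0.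
rewrite dot_vfieldB.
have D0 y : 0 <= dot (radial g (x + y) - radial g (x' + y)) (x - x').
  by rewrite [X in dot _ X](E y); exact: dot_radialB_ge0.
have cD : continuous (fun y => dot (radial g (x + y) - radial g (x' + y)) (x - x')).
  rewrite (_ : (fun y => _) = fun y => dot (radial g (x + y)) (x - x') -
      dot (radial g (x' + y)) (x - x')); last by apply/funext => y; rewrite dotBl.
  by apply: continuousB_comp; exact: radial_dot_continuous.
case: hyp => [g_sincr|[_ g_gt0 off_line]].
  apply: (Rintegral_gt0 mufin mur (A := setT)) => //; first by case: mufin.
  move=> y _; rewrite [X in dot _ X](E y); apply: dot_radialB_gt0_incr => //.
  by apply: contra_neq xx' => /addIr.
have u0 : x - x' != 0 by rewrite subr_eq0.
apply: (Rintegral_gt0 mufin mur (A := ~` affine_line (- x) (x - x'))) => //.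
- apply: measurable_open; exact/closed_openC/closed_affine_line.
- exact: off_line.
- by move=> y yline; exact: dot_radialB_gt0_offline.
Qed.

End FixedMeasure.
End Field.

(** * Weak convergence and the resulting convergence of zeros *)

Lemma continuous_pairr {T U : topologicalType} (x : T) :
  continuous (fun y : U => (x, y)).
Proof. by move=> y; apply: cvg_pair => /=; [exact: cvg_cst|exact: cvg_id]. Qed.

Section WeakConvergence.
Context {R : realType} {n : nat}.
Variables (mu_ : nat -> {measure set (borelRn R n) -> \bar R}).
Variables (mu : {measure set (borelRn R n) -> \bar R}) (r : R).
Hypotheses (mu_fin : forall k, finite_nonzero (mu_ k)).
Hypotheses (mu_r : forall k, mu_ k (~` eball r) = 0%E).
Hypotheses (mufin : finite_nonzero mu) (mur : mu (~` eball r) = 0%E).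
Hypothesis wcvg : weak_cvg mu_ mu.

(* Outside the common carrier the test function may be clamped to make it
   bounded without changing any of the integrals. *)
Lemma weak_cvg_carried (f : 'rV[R]_n -> R) : continuous f ->
  (\int[mu_ k]_(y in setT) f y) @[k --> \oo] --> \int[mu]_(y in setT) f y.
Proof.
move=> cf.
have [M M0 fM] : exists2 M, 0 <= M & forall y, enorm y <= r -> `|f y| <= M.
  have [B0|/set0P B0] := eqVneq (eball r : set 'rV[R]_n) set0.
    by exists 0 => // y yr; have : (eball r : set 'rV[R]_n) y by []; rewrite B0.
  have [|||c _ hc] := @EVT_max_rV R n (fun y => `|f y|) (eball r) => //.
  - exact: compact_eball.
  - exact/continuous_subspaceT/continuous_norm_comp.
  by exists `|f c| => // y yr; apply: hc; exact/mem_set.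
pose h y := Num.max (- M) (Num.min M (f y)).
have ch : continuous h.
  exact: continuous_clamp.
have hf y : enorm y <= r -> h y = f y.
  move=> /fM; rewrite ler_norml /h => /andP[Mf fM'].
  by rewrite min_r// max_r.
have bh : bounded_fun h.
  exists M; split=> [|N MN y _ /=]; first exact: num_real.
  rewrite (le_trans _ (ltW MN))// ler_norml /h le_max lexx/= ge_max.
  by rewrite ge_min lexx/= andbT; lra.
have E (nu : {measure set (borelRn R n) -> \bar R}) : finite_nonzero nu ->
    nu (~` eball r) = 0%E ->
    \int[nu]_(y in setT) f y = \int[nu]_(y in setT) h y.
  move=> nufin nur; rewrite !(Rintegral_eball nufin nur)//.
  by apply: eq_Rintegral => y /set_mem yr; rewrite hf.
rewrite (E mu)//; under eq_fun do rewrite E//.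
exact: wcvg.
Qed.

(** Joint in x' and k, for the compactness argument on a sphere. Replacing x' by x costs a uniform
    error times the mass of [mu_ k]; weak convergence deals with the fixed x. *)
Lemma weak_cvg_near_le (F : 'rV[R]_n * 'rV[R]_n -> R) x (e : R) :
  continuous F -> 0 < e ->
  \forall x' \near x & k \near \oo,
    `|\int[mu_ k]_(y in setT) F (x', y) - \int[mu]_(y in setT) F (x, y)| <= e.
Proof.
move=> cF e0; pose m := fine (mu setT).
have m0 : 0 < m by exact: mass_gt0.
have cFx x' : continuous (fun y => F (x', y)).
  move=> y; apply: (@continuous_comp _ _ _ (fun y => (x', y)) F); last exact: cF.
  exact: continuous_pairr.
(* The constant test function 1 bounds the masses eventually. *)
have mass_le : \forall k \near \oo, fine (mu_ k setT) <= m + 1.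
  have := @weak_cvg_carried (cst 1) (@cst_continuous _ _ _).
  rewrite Rintegral_cst// mul1r => /cvgrPdist_le/(_ _ ltr01).
  apply: filterS => k; rewrite Rintegral_cst// mul1r -/m ler_norml => /andP[]; lra.
have em : 0 < e / 2 / (m + 1) by rewrite !divr_gt0// addr_gt0.
have e2 : 0 < e / 2 by rewrite divr_gt0.
have near_x := near_uniform r x cF em.
have near_k := (cvgrPdist_le _ _).1 (weak_cvg_carried (cFx x)) _ e2.
near=> x' k => /=.
rewrite -(subrK (\int[mu_ k]_(y in setT) F (x, y)) (\int[mu_ k]_(y in setT) _)).
rewrite -addrA (splitr e) (le_trans (ler_normD _ _))// lerD//; last first.
  by rewrite distrC; near: k; exact: near_k.
apply: (@le_trans _ _ (e / 2 / (m + 1) * fine (mu_ k setT))).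
  apply: (dist_Rintegral_carried (mu_fin k) (mu_r k)) => //.
  by near: x'; exact: near_x.
rewrite -[leRHS](@divfK _ (m + 1)) ?gt_eqF ?addr_gt0// ler_wpM2l ?(ltW em)//.
by near: k; exact: mass_le.
Unshelve. all: by end_near.
Qed.

Variable g : R -> R.
Hypotheses (cg : continuous g) (g0 : g 0 = 0) (g_incr : increasing g).

(* On the sphere of radius e around x, <V_mu z, z - x> is positive, hence so is
   <V_(mu_ k) z, z - x> for k large, uniformly in z; by monotonicity the zero
   x_ k then cannot lie outside the ball. *)
Lemma weak_cvg_vfield_zero (x_ : nat -> 'rV[R]_n) x :
  strictly_increasing g \/ uniq_cond_ii g mu ->
  (forall k, vfield g (mu_ k) (x_ k) = 0) -> vfield g mu x = 0 ->
  x_ k @[k --> \oo] --> x.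
Proof.
move=> hyp x_zero x0; apply/cvgrPdist_le => e e0.
pose S : set 'rV[R]_n := [set z | enorm (z - x) = e].
have cS : compact S.
  have cd : continuous (fun z : 'rV[R]_n => enorm (z - x)).
    exact: enorm_subr_continuous.
  apply: (subclosed_compact _ (@compact_eball R n (e + enorm x))).
    apply: (@preimage_closed _ _ (fun z : 'rV[R]_n => enorm (z - x)) [set e]).
      by move=> z _; exact: cd.
    exact: closed_eq.
  move=> z; rewrite /S/= => ze; rewrite /eball/= -ze.
  by rewrite (le_trans _ (ler_enormD _ _))// subrK.
have pos : \forall k \near \oo, S `<=` (fun z => 0 < dot (vfield g (mu_ k) z) (z - x)).
  apply: ((compact_near_coveringP S).1 cS) => z Sz.
  pose F (p : 'rV[R]_n * 'rV[R]_n) := dot (radial g (p.1 + p.2)) (p.1 - x).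
  have cF : continuous F.
    apply: dot_continuous.
      move=> p; apply: (@continuous_comp _ _ _
        (fun p : 'rV[R]_n * 'rV[R]_n => p.1 + p.2) (radial g)).
        exact: add_continuous.
      exact: radial_continuous.
    move=> p; apply: (@continuousB _ _ _ (fun p : 'rV[R]_n * 'rV[R]_n => p.1) (cst x)).
      exact: cvg_fst.
    exact: cst_continuous.
  have zx : z != x.
    by apply: contra_eq_neq Sz => ->; rewrite subrr enorm0 lt_eqF.
  have d0 := vfield_strictly_monotone cg g0 mufin mur hyp zx.
  rewrite x0 subr0 (dot_vfield cg g0 mufin mur) in d0.
  (* Half of the limit value as tolerance leaves the nearby integrals positive. *)
  have d2 : 0 < (\int[mu]_(y in setT) F (z, y)) / 2 by rewrite divr_gt0.
  apply: filterS (weak_cvg_near_le z cF d2) => -[z' k] /=.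
  rewrite (dot_vfield cg g0 (mu_fin k) (mu_r k)) ler_norml => /andP[+ _].
  rewrite /F/= in d0 d2 *; lra.
apply: filterS pos => k pos_k; rewrite distrC.
rewrite (le_trans (normr_le_enorm _))// leNgt; apply/negP => ek.
set d := enorm (x_ k - x) in ek; have d0 : 0 < d by exact: lt_trans ek.
(* The point where the segment from x to [x_ k] crosses the sphere. *)
pose z := x + (e / d) *: (x_ k - x).
have zx : z - x = (e / d) *: (x_ k - x) by rewrite addrAC subrr add0r.
have /pos_k : S z.
  by rewrite /S/= zx enormZ gtr0_norm ?divr_gt0// divfK// gt_eqF.
have := vfield_monotone cg g0 (mu_fin k) (mu_r k) z (x_ k) g_incr.
have -> : z - x_ k = (1 - d / e) *: (z - x).
  rewrite zx scalerA mulrBl mul1r mulrA divfK ?gt_eqF// divff ?gt_eqF//.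
  by rewrite scalerBl scale1r -zx opprB addrA subrK.
(* The factor [1 - d / e] is negative, so monotonicity contradicts positivity on the sphere. *)
rewrite x_zero subr0 dotZr => h1 h2.
have : 1 < d / e by rewrite ltr_pdivlMr// mul1r.
nra.
Qed.

End WeakConvergence.

(** * Passage from the half-line to the whole line, and coercivity *)

Section EvenExtension.
Context {R : realType}.
Variable g : R -> R.

(** Continuity is given on the half-line only, while [primitive], based at -1, also reads negative
    arguments. Composing with the absolute value gives continuity on all of R and leaves the field
    unchanged. *)
Definition even_ext (r : R) : R := g `|r|.

Lemma even_extE r : 0 <= r -> even_ext r = g r.
Proof. by move=> r0; rewrite /even_ext ger0_norm. Qed.

Lemma even_ext_continuous :
  {within `[0, +oo[, continuous g} -> continuous even_ext.
Proof.
move=> /subspace_continuousP hg r.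
have r0 : `[0, +oo[%classic `|r| by rewrite /= in_itv/= normr_ge0.
have hnorm : `|x| @[x --> r] --> within `[0, +oo[ (nbhs `|r|).
  move=> A DA; have hA : \forall x \near r, `[0, +oo[%classic `|x| -> A `|x|.
    exact: (@norm_continuous _ R^o r _ DA).
  change (\forall x \near r, A `|x|); apply: filterS hA => x; apply.
  by rewrite /= in_itv/= normr_ge0.
exact: cvg_comp hnorm (hg _ r0).
Qed.

Lemma even_ext_radial n : @radial R n even_ext = @radial R n g.
Proof.
by apply/funext => y; rewrite /radial even_extE// enorm_ge0.
Qed.

Lemma even_ext_vfield n : @vfield R n even_ext = @vfield R n g.
Proof. by apply/funext => mu; apply/funext => x; rewrite /vfield even_ext_radial. Qed.

Lemma even_ext_strictly_increasing :
  strictly_increasing g -> strictly_increasing even_ext.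
Proof.
move=> g_sincr r s r0 s0 rs; have := r0; have := s0.
by rewrite !in_itv/= !andbT => s0' r0'; rewrite !even_extE// g_sincr.
Qed.

Lemma even_ext_increasing : increasing g -> increasing even_ext.
Proof.
move=> g_incr r s r0 s0 rs; have := r0; have := s0.
by rewrite !in_itv/= !andbT => s0' r0'; rewrite !even_extE// g_incr.
Qed.

Lemma even_ext_uniq_cond_ii n (mu : {measure set (borelRn R n) -> \bar R}) :
  uniq_cond_ii g mu -> uniq_cond_ii even_ext mu.
Proof.
move=> [g_incr g_gt0 off_line]; split=> //; first exact: even_ext_increasing.
by move=> r r0; rewrite even_extE ?ltW// g_gt0.
Qed.

(** The base point -1 shifts the integral from 0 by the constant [primitive even_ext 0], absorbed
    into the threshold. *)
Lemma even_ext_coercive : {within `[0, +oo[, continuous g} ->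
  improper_integral_infty g -> forall M : R,
  exists2 rho : R, 0 <= rho & forall s : R, rho <= s -> M <= primitive even_ext s.
Proof.
move=> hg /cvgryPge hinf M.
have [rho [_ hrho]] := hinf (M - primitive even_ext 0).
(* The bound is known only for s > rho, strictly, and [rho] may be negative; this witness handles
   both. *)
exists (`|rho| + 1); first by rewrite addr_ge0.
move=> s rs; have s0 : 0 <= s by have := normr_ge0 rho; lra.
rewrite (primitive_itv (even_ext_continuous hg) s0) -lerBlDl.
have -> : \int[lebesgue_measure]_(x in `[0, s]) even_ext x =
    \int[lebesgue_measure]_(x in `[0, s]) g x.
  apply: eq_Rintegral => x /set_mem/=; rewrite in_itv/= => /andP[x0 _].
  by rewrite even_extE.
by apply: hrho; have := ler_norm rho; lra.
Qed.

End EvenExtension.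

(** By the mean value theorem the primitive grows past 1 with slope at least g 1; over the length
    [d] this makes up for |M - primitive g 1|. *)
Lemma increasing_coercive {R : realType} (g : R -> R) :
  continuous g -> increasing g -> 0 < g 1 -> forall M : R,
  exists2 rho : R, 0 <= rho & forall s : R, rho <= s -> M <= primitive g s.
Proof.
move=> cg g_incr g1 M; pose d := `|M - primitive g 1| / g 1.
have d0 : 0 <= d by rewrite divr_ge0// ltW.
exists (1 + d); first by rewrite addr_ge0.
move=> s ds; have s1 : 1 <= s by lra.
have [c [c1 cs e]] := primitive_mvt cg ler01 s1.
have gc : g 1 <= g c by apply: g_incr => //; rewrite in_itv/= ?ler01//; lra.
have : `|M - primitive g 1| <= g 1 * (s - 1).
  by rewrite mulrC -ler_pdivrMr// -/d; lra.
have := ler_norm (M - primitive g 1).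
have : g 1 * (s - 1) <= g c * (s - 1) by rewrite ler_wpM2r// subr_ge0.
by rewrite -e; lra.
Qed.

(** * Existence, uniqueness and continuous dependence combined *)

Unset Implicit Arguments.
Set Strict Implicit.
Set Printing Implicit Defensive.

Theorem theorem1 (R : realType) (n : nat) (hn : (1 <= n)%N)
    (g : R -> R) (hg : {within `[0, +oo[, continuous g}) (hg0 : g 0 = 0)
    (mu : {measure set (borelRn R n) -> \bar R})
    (hmu : finite_nonzero mu) (hsupp : compactly_supported mu) :
  [/\ (improper_integral_infty g -> exists xc : 'rV[R]_n, vfield g mu xc = 0),
      (strictly_increasing g \/ uniq_cond_ii g mu ->
        exists! xc : 'rV[R]_n, vfield g mu xc = 0)
    & forall mu_ : nat -> {measure set (borelRn R n) -> \bar R},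
        (forall k, finite_nonzero (mu_ k)) ->
        (exists2 K : set 'rV[R]_n, compact K &
          forall k, supported_in (mu_ k) K) ->
        weak_cvg mu_ mu ->
        strictly_increasing g \/
          (uniq_cond_ii g mu /\ forall k, uniq_cond_ii g (mu_ k)) ->
        zero_point g (mu_ k) @[k --> \oo] --> zero_point g mu].
Proof.
have [r0 mu_r0] := compactly_supported_eball hsupp.
have cg := even_ext_continuous hg.
have g0 : even_ext g 0 = 0 by rewrite even_extE.
have hyp_ext (nu : {measure set (borelRn R n) -> \bar R}) :
    strictly_increasing g \/ uniq_cond_ii g nu ->
    strictly_increasing (even_ext g) \/ uniq_cond_ii (even_ext g) nu.
  by case=> h; [left; exact: even_ext_strictly_increasing|
                right; exact: even_ext_uniq_cond_ii].
have incr_ext (nu : {measure set (borelRn R n) -> \bar R}) :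
    strictly_increasing g \/ uniq_cond_ii g nu -> increasing (even_ext g).
  move=> /hyp_ext[g_sincr s t s0 t0|[]//].
  by rewrite le_eqVlt => /predU1P[->//|st]; exact/ltW/g_sincr.
(* Under (i) or (ii) the extension is increasing and positive at 1, which makes its primitive
   coercive. *)
have zero_ex (nu : {measure set (borelRn R n) -> \bar R}) r :
    finite_nonzero nu -> nu (~` eball r) = 0%E ->
    strictly_increasing g \/ uniq_cond_ii g nu ->
    exists x, vfield g nu x = 0.
  move=> nufin nur hyp; rewrite -even_ext_vfield.
  apply: (vfield_zero_of_coercive cg g0 nufin nur).
  apply: increasing_coercive cg (incr_ext _ hyp) _.
  case: (hyp_ext _ hyp) => [g_sincr|[_ + _]]; last exact.
  by rewrite -g0 g_sincr// in_itv/= ?lexx ?ler01.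
split.
- move=> hinf; rewrite -even_ext_vfield.
  exact: (vfield_zero_of_coercive cg g0 hmu mu_r0 (even_ext_coercive hg hinf)).
- move=> hyp; have [x xE] := zero_ex _ _ hmu mu_r0 hyp; exists x; split=> // x' x'E.
  apply/eqP; apply: contraT => xx'.
  have := vfield_strictly_monotone cg g0 hmu mu_r0 (hyp_ext _ hyp) xx'.
  by rewrite even_ext_vfield xE x'E subr0 dot0l ltxx.
- move=> mu_ mu_fin [K cK mu_K] wcvg hyp.
  have hyp_mu : strictly_increasing g \/ uniq_cond_ii g mu.
    by case: hyp => [|[]]; [left|right].
  have hyp_mu_ k : strictly_increasing g \/ uniq_cond_ii g (mu_ k).
    by case: hyp => [|[_ ?]]; [left|right].
  have [r1 _ Kr1] := compact_sub_eball cK.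
  (* One ball must carry the limit and all the [mu_ k]: r0 serves [mu], r1 serves the sequence. *)
  pose r := Num.max r0 r1.
  have mur : mu (~` eball r) = 0%E.
    apply: subset_measure0 mu_r0.
    + by apply: measurableC; exact: measurable_eball.
    + by apply: measurableC; exact: measurable_eball.
    + by apply: subsetC => y; rewrite /eball/= => yr; rewrite le_max yr.
  have mu_r k : mu_ k (~` eball r) = 0%E.
    apply: subset_measure0 (mu_K k).
    + by apply: measurableC; exact: measurable_eball.
    + apply: measurable_open; apply: closed_openC.
      by apply: compact_closed cK; exact: norm_hausdorff.
    + by apply: subsetC => y /Kr1; rewrite /eball/= => yr; rewrite le_max yr orbT.
  apply: (weak_cvg_vfield_zero mu_fin mu_r hmu mur wcvg cg g0
            (incr_ext _ hyp_mu) (hyp_ext _ hyp_mu)).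
  (* [zero_point] is a [get], hence a genuine zero as soon as one exists. *)
  + by move=> k; rewrite even_ext_vfield; exact: getPex (zero_ex _ _ _ (mu_r k) _).
  + by rewrite even_ext_vfield; exact: getPex (zero_ex _ _ hmu mur hyp_mu).
Qed.
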